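(* Let $f$ be quasi-convex on $Q$, i.e. $f((1-\alpha)x+\alpha y)\le\max\{f(x),f(y)\}$ for all $\alpha\in[0,1]$, $x,y\in Q$, and locally Lipschitz; let $g:Q\to\mathbb{R}$ be convex and satisfy $|g(x)-g(y)|\le M_g\|x-y\|$ for all $x,y\in Q$; and let $x_*$ be a solution of $\min\{f(x):x\in Q,\ g(x)\le0\}$ with $d(x_* )\le\Theta_0^2$, $\Theta_0>0$. Let $\varepsilon>0$ and run Adaptive Mirror Descent (described in the context) with accuracy $\varepsilon$ for $N=\left\lceil 2\Theta_0^2/\varepsilon^2\right\rceil$ steps, and let $I\subset\{0,\dots,N-1\}$ be the set of indices of productive steps. Then $I\ne\emptyset$ and $$\min_{k\in I}v_f(x^k,x_* )\le\varepsilon,\qquad\max_{k\in I}g(x^k)\le\varepsilon M_g .$$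
   Context: $(E,\|\cdot\|)$ is a finite-dimensional normed space with dual $E^*$ and dual norm $\|y\|_*=\max\{\langle y,x\rangle:\|x\|\le1\}$; $Q\subset E$ is a closed convex set. $d:Q\to\mathbb{R}$ is a non-negative, continuously differentiable function that is $1$-strongly convex: $\langle\nabla d(x)-\nabla d(y),x-y\rangle\ge\|x-y\|^2$ for all $x,y\in Q$. The Bregman divergence is $V(x,y)=d(y)-d(x)-\langle\nabla d(x),y-x\rangle$, and for $x\in Q$, $p\in E^*$, $\mathrm{Mirr}_x(p)=\arg\min_{u\in Q}\{\langle p,u\rangle+V(x,u)\}$. The function $f$ is defined and locally Lipschitz on an open set containing $Q$, and $\nabla f(x)$ denotes an arbitrary (fixed) element of the Clarke subdifferential of $f$ at $x$. $\nabla g(x)$ denotes an arbitrary (fixed) subgradient of the convex function $g$ at $x\in Q$ with $\|\nabla g(x)\|_*\le M_g$. $v_f(y,x_* )=\left\langle\frac{\nabla f(y)}{\|\nabla f(y)\|_*},y-x_*\right\rangle$ if $\nabla f(y)\ne0$, and $v_f(y,x_* )=0$ if $\nabla f(y)=0$. Adaptive Mirror Descent with accuracy $\varepsilon$: start from $x^0=\arg\min_{x\in Q}d(x)$, $I=\emptyset$. At step $k=0,1,\dots$: if $g(x^k)\le\varepsilon\|\nabla g(x^k)\|_*$ (productive step), put $h_k=\varepsilon/\|\nabla f(x^k)\|_*$, $x^{k+1}=\mathrm{Mirr}_{x^k}(h_k\nabla f(x^k))$ and add $k$ to $I$; otherwise (non-productive step), put $h_k=\varepsilon/\|\nabla g(x^k)\|_*$,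 $x^{k+1}=\mathrm{Mirr}_{x^k}(h_k\nabla g(x^k))$. The (sub)gradients by whose norms one divides are assumed to be nonzero. *)

(* Defs.v *)
From HB Require Import structures.
From mathcomp Require Import all_boot all_order all_algebra.
From mathcomp Require Import all_classical all_reals all_analysis.

Set Implicit Arguments.
Unset Strict Implicit.
Unset Printing Implicit Defensive.

Import Order.TTheory GRing.Theory Num.Theory.
Import numFieldNormedType.Exports.

Local Open Scope classical_set_scope.
Local Open Scope ring_scope.

(* Finite-dimensional normed spaces: the norm is an arbitrary one, unrelated to
   the coordinates provided by the vectType structure. *)
#[short(type="normedVectType")]
HB.structure Definition NormedVector (R : numFieldType) :=
  {V of NormedModule R V & Vector R V}.

Section Definitions.
Context {R : realType} {E : normedVectType R}.

(* All linear functionals: in finite dimension they are all continuous. *)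
Definition dual_space : vectType R := 'Hom(E, R^o).

(* The supremum is attained, the unit ball of E being compact. *)
Definition dnorm (p : dual_space) : R := sup [set p x | x in [set x : E | `|x| <= 1]].

Definition argmin (A : set E) (F : E -> R) : set E :=
  [set u | A u /\ forall w, A w -> F u <= F w].

Definition quasi_convex_on (Q : set E) (f : E -> R) : Prop :=
  forall (a : R) (x y : E), 0 <= a <= 1 -> Q x -> Q y ->
    f ((1 - a) *: x + a *: y) <= Num.max (f x) (f y).

Definition locally_lipschitz_on (U : set E) (f : E -> R) : Prop :=
  forall x, U x -> exists2 W, nbhs x W & [lipschitz f z | z in W].

(* limsup of (f (y + t v) - f y) / t as y --> x and t decreases to 0. *)
Definition clarke_derivative (f : E -> R) (x v : E) : \bar R :=
  limf_esup (fun yt : E * R => ((f (yt.1 + yt.2 *: v) - f yt.1) / yt.2)%:E)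
    (filter_prod (nbhs x) (0 : R)^'+).

Definition clarke_subdifferential (f : E -> R) (x : E) : set dual_space :=
  [set p | forall v, ((p v)%:E <= clarke_derivative f x v)%E].

Definition subdifferential_on (Q : set E) (g : E -> R) (x : E) : set dual_space :=
  [set p | forall y, Q y -> g x + p (y - x) <= g y].

(* d is only considered on Q, which may have empty interior; the derivative is
   taken along Q.  It may then fail to be unique, but its values on differences
   of points of Q, the only ones that matter for V below, are determined. *)
Definition C1_on (Q : set E) (d : E -> R) (nabla_d : E -> dual_space) : Prop :=
  (forall x, Q x -> forall e : R, 0 < e -> \forall y \near within Q (nbhs x),
     `|d y - d x - nabla_d x (y - x)| <= e * `|y - x|) /\
  (forall x, Q x -> forall e : R, 0 < e -> \forall y \near within Q (nbhs x),
     dnorm (nabla_d y - nabla_d x) <= e).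

Definition strongly_convex1_on (Q : set E) (nabla_d : E -> dual_space) : Prop :=
  forall x y, Q x -> Q y -> (nabla_d x - nabla_d y) (x - y) >= `|x - y| ^+ 2.

Definition bregman (d : E -> R) (nabla_d : E -> dual_space) (x y : E) : R :=
  d y - d x - nabla_d x (y - x).

(* Mirr_x(p), as the set of minimizers; strong convexity makes it a singleton. *)
Definition mirr (Q : set E) (d : E -> R) (nabla_d : E -> dual_space) (x : E)
    (p : dual_space) : set E :=
  argmin Q (fun u => p u + bregman d nabla_d x u).

Definition vf (nabla_f : E -> dual_space) (y xs : E) : R :=
  if nabla_f y == 0 then 0
  else ((dnorm (nabla_f y))^-1 *: nabla_f y) (y - xs).

Definition productive (g : E -> R) (nabla_g : E -> dual_space) (eps : R) (y : E)
  : bool := g y <= eps * dnorm (nabla_g y).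

(* The (sub)gradient used in a step from y. *)
Definition step_grad (g : E -> R) (nabla_f nabla_g : E -> dual_space) (eps : R)
    (y : E) : dual_space :=
  if productive g nabla_g eps y then nabla_f y else nabla_g y.

Definition amd_run (Q : set E) (d : E -> R) (nabla_d : E -> dual_space) (g : E -> R)
    (nabla_f nabla_g : E -> dual_space) (eps : R) (N : nat) (x : nat -> E) : Prop :=
  argmin Q d (x 0%N) /\
  forall k, (k < N)%N ->
    let p := step_grad g nabla_f nabla_g eps (x k) in
    let h := eps / dnorm p in
    mirr Q d nabla_d (x k) (h *: p) (x k.+1).

End Definitions.

(* Main.v *)
(* First-order optimality of the Mirr step and V(x, y) >= |y - x|^2 / 2 give,
   for h = eps / |p| (dual norm) and every u in Q,
     h <p, x_k - u> <= eps^2 / 2 + V(x_k, u) - V(x_{k+1}, u).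
   Take u = xs.  At a non-productive step the left-hand side exceeds eps^2,
   because g(xs) <= 0 and g is convex.  If v_f(x_k, xs) > eps at every
   productive step, it exceeds eps^2 there as well, so V(x_k, xs) drops by more
   than eps^2 / 2 at each of the N steps.  This is impossible, since
   0 <= V(x_k, xs), V(x_0, xs) <= d(xs) <= Theta0^2 and
   N >= 2 Theta0^2 / eps^2. *)
Require Import Defs.
From HB Require Import structures.
From mathcomp Require Import all_boot all_order all_algebra.
From mathcomp Require Import all_classical all_reals all_analysis.
From mathcomp Require Import ring lra.

Set Implicit Arguments.
Unset Strict Implicit.
Unset Printing Implicit Defensive.

Import Order.TTheory GRing.Theory Num.Theory.
Import numFieldNormedType.Exports.

Local Open Scope classical_set_scope.
Local Open Scope ring_scope.

(** * Dual norm in finite dimension *)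

Section DualNorm.
Context {R : realType} {E : normedVectType R}.
Implicit Types (p q : @dual_space R E) (x y : E).

(* The values of a dual element live in [R^o]; these versions of the morphism
   lemmas bring them back to [R], where [ring] and [lra] apply. *)
Lemma dualD p x y : p (x + y) = p x + p y :> R.
Proof. exact: linearD. Qed.

Lemma dualB p x y : p (x - y) = p x - p y :> R.
Proof. exact: linearB. Qed.

Lemma dualZ p (a : R) x : p (a *: x) = a * p x :> R.
Proof. exact: linearZ. Qed.

Lemma add_dualE p q x : (p + q) x = p x + q x :> R.
Proof. exact: add_lfunE. Qed.

Lemma sub_dualE p q x : (p - q) x = p x - q x :> R.
Proof. by rewrite add_dualE opp_lfunE. Qed.

Lemma scale_dualE (a : R) p x : (a *: p) x = a * p x :> R.
Proof. exact: scale_lfunE. Qed.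

(* The image of the unit sphere of 'rV_n under the coordinate isomorphism is
   compact and avoids 0, so the norm of E is bounded below on it. *)
Lemma coord_bounded : exists2 C : R, 0 <= C &
  forall x i, `|coord (vbasis {:E}) i x| <= C * `|x|.
Proof.
set b := vbasis {:E}; pose n : nat := \dim {:E}.
have bfree : free b by exact: basis_free (vbasisP _).
pose T (r : 'rV[R]_n) : E := \sum_i r 0 i *: b`_i.
have TE x : T (\row_i coord b i x) = x.
  rewrite [RHS](coord_vbasis (memvf x)); apply: eq_bigr => i _.
  by rewrite mxE.
have rowT (r : 'rV[R]_n) i : coord b i (T r) = r 0 i by exact: coord_sum_free.
have TZ a (r : 'rV[R]_n) : T (a *: r) = a *: T r.
  by rewrite /T scaler_sumr; apply: eq_bigr => i _; rewrite mxE scalerA.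
have Tcont : continuous (fun r : 'rV[R]_n => `|T r|).
  have Tc : continuous T.
    have sumc := @continuous_big E 'I_n +%R 0 xpredT (@add_continuous E)
      _ (index_enum 'I_n) (fun i (r : 'rV[R]_n) => r 0 i *: b`_i).
    refine (sumc _) => i _ r.
    apply: (@cvgZr_tmp _ _ _ (nbhs r)); exact: coord_continuous.
  by move=> r; exact: (cvg_norm (Tc r)).
pose S := [set r : 'rV[R]_n | `|r| = 1].
(* The sphere is empty only when [E] is trivial; all coordinates then vanish. *)
have [S0|S0] := pselect (S !=set0); last first.
  exists 0 => // x i; rewrite mul0r -(TE x) rowT normr_le0.
  set r := \row_i _; have [->|r0] := eqVneq r 0; first by rewrite mxE.
  exfalso; apply: S0; exists (`|r|^-1 *: r).
  by rewrite /S /= normrZ normfV normr_id mulVf ?normr_eq0.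
have Sclosed : closed S.
  rewrite (_ : S = (fun r : 'rV[R]_n => `|r|) @^-1` [set 1]) //.
  by apply: closed_comp => [r _|]; [exact: norm_continuous|exact: closed_eq].
have Scompact : compact S.
  apply: bounded_closed_compact => //; exists 1; split => // M M1 r.
  by rewrite /S /= => ->; exact: ltW.
have [c] := compact_EVT_min S0 Scompact (continuous_subspaceT Tcont).
rewrite inE /S /= => c1 cmin.
have m0 : 0 < `|T c|.
  rewrite normr_gt0; apply/eqP => Tc0.
  suff c0 : c = 0 by move: c1; rewrite c0 normr0 => /esym/eqP; rewrite oner_eq0.
  by apply/rowP => i; rewrite -rowT Tc0 linear0 mxE.
(* By homogeneity, the inverse of the minimum of [|T r|] over the unit sphere serves as [C]. *)
exists `|T c|^-1 => [|x i]; first by rewrite invr_ge0 ltW.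
rewrite mulrC ler_pdivlMr// -{1 2}(TE x) rowT; set r := \row_i _.
have le_ri : `|r 0 i| <= `|r|.
  rewrite [leRHS]/Num.norm /= mx_normrE.
  exact: (le_bigmax _ (fun k : 'I_1 * 'I_n => `|r k.1 k.2|) (ord0, i)).
apply: (le_trans (ler_wpM2r (ltW m0) le_ri)).
have [->|r0] := eqVneq r 0; first by rewrite normr0 mul0r normr_ge0.
have nr0 : 0 < `|r| by rewrite normr_gt0.
rewrite mulrC -ler_pdivlMr// mulrC -[leRHS](_ : `|T (`|r|^-1 *: r)| = _).
  by apply: cmin; rewrite inE /S /= normrZ normfV normr_id mulVf ?gt_eqF.
by rewrite TZ normrZ normfV normr_id.
Qed.

Lemma dual_bounded p : exists C : R, forall x, `|p x| <= C * `|x|.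
Proof.
have [C C0 hC] := coord_bounded.
exists (\sum_(i < \dim {:E}) C * `|p (vbasis {:E})`_i|) => x.
rewrite {1}(coord_vbasis (memvf x)) linear_sum mulr_suml.
apply: le_trans (ler_norm_sum _ _ _) _; apply: ler_sum => i _.
rewrite linearZ /= normrM mulrAC; exact: ler_wpM2r.
Qed.

(** Guarantees that the [sup] in [dnorm] is a genuine supremum and not a default value. *)
Lemma dnorm_ub p : has_ubound [set p x | x in [set x : E | `|x| <= 1]].
Proof.
have [C hC] := dual_bounded p.
exists `|C| => _ [x /= x1 <-]; apply: le_trans (ler_norm _) _.
apply: le_trans (hC x) _; apply: le_trans (ler_wpM2r _ (ler_norm C)) _ => //.
by rewrite ler_piMr.
Qed.

Lemma dual_le_dnorm p x : p x <= dnorm p * `|x|.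
Proof.
have [->|x0] := eqVneq x 0; first by rewrite linear0 normr0 mulr0.
have nx0 : 0 < `|x| by rewrite normr_gt0.
rewrite -ler_pdivrMr// mulrC.
have -> : `|x|^-1 * p x = p (`|x|^-1 *: x) by rewrite linearZ.
apply: (ub_le_sup (dnorm_ub p)); exists (`|x|^-1 *: x) => //=.
by rewrite normrZ normfV normr_id mulVf ?gt_eqF.
Qed.

(** If [dnorm p <= 0], then [p] is nonpositive at both [y] and [- y], hence zero. *)
Lemma dnorm_gt0 p : p <> 0 -> 0 < dnorm p.
Proof.
move=> p0; rewrite ltNge; apply/negP => dn_le0; apply: p0; apply/lfunP => x.
rewrite lfunE /=.
have le0 y : p y <= 0.
  by apply: le_trans (dual_le_dnorm p y) _; rewrite mulr_le0_ge0.
by apply/eqP; rewrite eq_le le0 -oppr_le0 -linearN le0.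
Qed.

End DualNorm.

(** * Monotonicity on the unit interval *)

Section OneDim.
Context {R : realType}.
Variables psi dpsi : R -> R.

(* At 0 and 1 this is one-sided differentiability: the values of [psi] outside
   the unit interval are irrelevant. *)
Hypothesis psiE : forall t : R, 0 <= t <= 1 -> forall e : R, 0 < e ->
  \forall s \near t, 0 <= s <= 1 ->
  `|psi s - psi t - (s - t) * dpsi t| <= e * `|s - t|.

(** Mean value theorem: [psiE] gives continuity on the closed interval and a two-sided derivative
    inside. *)
Lemma ge0_slope_le01 : (forall t, 0 < t < 1 -> 0 <= dpsi t) -> psi 0 <= psi 1.
Proof.
move=> dpsi_ge0.
have psi_cont : {within `[0, 1], continuous psi}.
  apply/subspace_continuousP => t; rewrite /= in_itv /= => t01.
  apply/cvgrPdist_le => e e0.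
  have c1 : 0 < 1 + `|dpsi t| by rewrite ltr_pwDl.
  rewrite near_withinE; near=> s; rewrite /= in_itv /= => s01.
  have A : `|psi s - psi t - (s - t) * dpsi t| <= 1 * `|s - t|.
    by move: s01; near: s; exact: psiE.
  have B : `|s - t| * (1 + `|dpsi t|) <= e.
    rewrite -ler_pdivlMr // distrC; near: s; apply: cvgr_dist_le => //.
    exact: divr_gt0.
  rewrite distrC; apply: le_trans B.
  rewrite -[psi s - psi t](subrK ((s - t) * dpsi t)).
  apply: le_trans (ler_normD _ _) _.
  by rewrite mulrDr mulr1 normrM lerD // -[leRHS]mul1r.
have psi_deriv (t : R) : t \in `]0, 1[ -> is_derive t 1 psi (dpsi t).
  rewrite in_itv /= => t01.
  have t01' : 0 <= t <= 1 by case/andP: t01 => *; rewrite !ltW.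
  suff psi_cvg :
      h^-1 *: ((psi \o shift t) (h *: 1) - psi t) @[h --> 0^'] --> dpsi t.
    by apply: DeriveDef; [apply/cvg_ex; exists (dpsi t)|exact/cvg_lim].
  apply/cvgrPdist_le => e e0.
  have sh : h + t @[h --> (0 : R)^'] --> t.
    rewrite -[X in _ --> X]add0r; apply: cvgD; last exact: cvg_cst.
    exact: nbhs_dnbhs.
  near=> h.
  have h0 : h != 0 by near: h; exact: nbhs_dnbhs_neq.
  have ht01 : 0 <= h + t <= 1.
    near: h; apply: (sh [set s : R | 0 <= s <= 1]).
    have : \forall s \near t, s \in `]0, 1[ by exact: near_in_itvoo.
    by apply: filterS => s; rewrite in_itv /= => /andP[? ?]; rewrite !ltW.
  have : `|psi (h + t) - psi t - (h + t - t) * dpsi t| <= e * `|h + t - t|.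
    move: ht01; near: h; exact: (sh _ (psiE t01' e0)).
  rewrite addrK -ler_pdivrMr ?normr_gt0 // -normfV -normrM distrC.
  have -> : (psi (h + t) - psi t - h * dpsi t) / h =
      h^-1 * (psi (h + t) - psi t) - dpsi t by field.
  by rewrite /= [h%:A]mulr1.
have [c c01] := MVT ltr01 psi_deriv psi_cont.
rewrite subr0 mulr1 -subr_ge0 => ->; apply: dpsi_ge0.
by move: c01; rewrite in_itv.
Unshelve. all: end_near. Qed.

End OneDim.

(** * First-order optimality and strong convexity along segments *)

Section StrongConvexity.
Context {R : realType} {E : normedVectType R}.
Variables (Q : set E) (d : E -> R) (nabla_d : E -> @dual_space R E).
Hypotheses (Q_convex : convex_set Q) (d_C1 : C1_on Q d nabla_d).
Implicit Types (q : @dual_space R E) (x y z w : E).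

Let seg x y (t : R) : E := x + t *: (y - x).

Lemma convex_seg x y (t : R) : Q x -> Q y -> 0 <= t <= 1 -> Q (seg x y t).
Proof.
move=> Qx Qy /andP[t0 t1].
(* [conv] puts the weight [t] on its first argument, so [y] comes first. *)
have /set_mem := Q_convex (Itv01 t0 t1) (mem_set Qy) (mem_set Qx).
suff -> : seg x y t = conv (Itv01 t0 t1) (y : convex_lmodType E) x by [].
by rewrite /seg /conv /= /unstable.onem scalerBr scalerBl scale1r addrCA.
Qed.

(** Chain rule along a segment of [Q], in the form required by [psiE]. *)
Lemma seg_diff x y (t : R) : Q x -> Q y -> 0 <= t <= 1 ->
  forall e : R, 0 < e -> \forall s \near t, 0 <= s <= 1 ->
  `|d (seg x y s) - d (seg x y t) - (s - t) * nabla_d (seg x y t) (y - x)|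
    <= e * `|s - t|.
Proof.
move=> Qx Qy t01 e e0.
(* The summand 1 keeps the divisor positive when [y = x]. *)
have c0 : 0 < `|y - x| + 1 by rewrite ltr_wpDl.
have [/(_ _ (convex_seg Qx Qy t01) _ (divr_gt0 e0 c0)) dQ _] := d_C1.
have seg_cont : seg x y @ t --> seg x y t.
  apply: (@cvgD _ _ _ (nbhs t) _ (fun=> x) (fun s => s *: (y - x))).
    exact: cvg_cst.
  exact: (@cvgZr_tmp _ _ _ (nbhs t) _ id t (y - x) cvg_id).
have {}dQ := seg_cont _ dQ.
apply: (@filterS _ (nbhs t) _ _ _ _ dQ) => s /= ds s01.
have segB : seg x y s - seg x y t = (s - t) *: (y - x).
  by rewrite /seg opprD addrACA subrr add0r -scalerBl.
move: ds => /(_ (convex_seg Qx Qy s01)); rewrite segB dualZ.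
move/le_trans; apply.
rewrite normrZ mulrAC -mulrA ler_pM2l // ler_pdivrMr // mulrC.
by rewrite [leRHS]mulrC ler_wpM2r // lerDl.
Qed.

(** Minimality of [z] against the point [seg z w s], divided by a small [s > 0], bounds the
    right-hand side below by [- e] for every [e > 0]. *)
Lemma argmin_first_order q z w :
  argmin Q (fun u => q u + d u) z -> Q w -> 0 <= (q + nabla_d z) (w - z).
Proof.
move=> [Qz zmin] Qw; apply/ler_addgt0Pl => e e0.
have t00 : 0 <= (0 : R) <= 1 by rewrite lexx ler01.
have := seg_diff Qz Qw t00 e0 => /nbhs_ballP [r /= r0 hr].
pose s := Num.min (r / 2) 1.
have s0 : 0 < s by rewrite lt_min ltr01 divr_gt0.
have s1 : s <= 1 by rewrite ge_min lexx orbT.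
have s01 : 0 <= s <= 1 by rewrite ltW.
have sr : ball 0 r s.
  rewrite /ball /= sub0r normrN gtr0_norm // (@le_lt_trans _ _ (r / 2)) //.
    by rewrite ge_min lexx.
  by rewrite ltr_pdivrMr // ltr_pMr // ltr1n.
have := hr s sr s01; rewrite /seg scale0r addr0 subr0 (gtr0_norm s0) => ds.
have := zmin _ (convex_seg Qz Qw s01).
rewrite /seg dualD dualZ => zs.
rewrite add_dualE -(pmulr_rge0 _ s0).
move: ds; rewrite ler_norml => /andP[_ ds].
by rewrite !mulrDr (mulrC s e); lra.
Qed.

(** The claim is [psi 0 <= psi 1], where [psi] is [d] along the segment minus its linear part at [x]
    and the quadratic [t ^+ 2 * c / 2]. *)
Lemma bregman_ge (d_sc : strongly_convex1_on Q nabla_d) x y :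
  Q x -> Q y -> `|y - x| ^+ 2 / 2 <= bregman d nabla_d x y.
Proof.
move=> Qx Qy.
pose c : R := `|y - x| ^+ 2.
pose psi (t : R) :=
  d (seg x y t) - (t * nabla_d x (y - x) + t ^+ 2 * (c / 2)).
pose dpsi (t : R) : R :=
  nabla_d (seg x y t) (y - x) - (nabla_d x (y - x) + t * c).
have psiE (t : R) : 0 <= t <= 1 -> forall e : R, 0 < e ->
    \forall s \near t, 0 <= s <= 1 ->
    `|psi s - psi t - (s - t) * dpsi t| <= e * `|s - t|.
  move=> t01 e e0.
  have e20 : 0 < e / 2 by rewrite divr_gt0.
  have c1 : 0 < c / 2 + 1 by rewrite ltr_wpDl // divr_ge0 // sqr_ge0.
  near=> s => s01.
  have A : `|d (seg x y s) - d (seg x y t)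
             - (s - t) * nabla_d (seg x y t) (y - x)| <= e / 2 * `|s - t|.
    by move: s01; near: s; exact: seg_diff.
  have B : `|s - t| * (c / 2 + 1) <= e / 2.
    rewrite -ler_pdivlMr // distrC; near: s; apply: cvgr_dist_le => //.
    exact: divr_gt0.
  have -> : psi s - psi t - (s - t) * dpsi t =
      (d (seg x y s) - d (seg x y t)
       - (s - t) * nabla_d (seg x y t) (y - x))
      - (s - t) * ((s - t) * (c / 2)).
    by rewrite /psi /dpsi; field.
  apply: le_trans (ler_normB _ _) _.
  rewrite (splitr e) [leRHS]mulrDl lerD // normrM mulrC ler_wpM2r //.
  apply: le_trans B; rewrite normrM ler_wpM2l // ger0_norm ?lerDl //.
  by rewrite divr_ge0 // sqr_ge0.
have dpsi_ge0 (t : R) : 0 < t < 1 -> 0 <= dpsi t.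
  move=> /andP[t0 t1].
  have t01 : 0 <= t <= 1 by rewrite !ltW.
  (* Strong convexity between [seg x y t] and [x] yields [t * dpsi t >= 0]; the factor [t] then
     cancels. *)
  have := d_sc _ _ (convex_seg Qx Qy t01) Qx.
  rewrite {2 3}/seg addrAC subrr add0r normrZ exprMn (gtr0_norm t0) dualZ.
  rewrite -/c expr2 -mulrA ler_pM2l // sub_dualE /dpsi.
  by lra.
have := ge0_slope_le01 psiE dpsi_ge0.
rewrite /psi /seg scale0r addr0 scale1r (addrC x) subrK /bregman -/c.
by lra.
Unshelve. all: end_near. Qed.

End StrongConvexity.

(** * One step of mirror descent *)

Section MirrorDescent.
Context {R : realType} {E : normedVectType R}.
Variables (Q : set E) (d : E -> R) (nabla_d : E -> @dual_space R E).
Hypotheses (Q_convex : convex_set Q) (d_C1 : C1_on Q d nabla_d).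
Hypothesis d_sc : strongly_convex1_on Q nabla_d.
Implicit Types (p : @dual_space R E) (x y u : E).

Lemma bregman_ge0 x y : Q x -> Q y -> 0 <= bregman d nabla_d x y.
Proof.
move=> Qx Qy; apply: le_trans (bregman_ge Q_convex d_C1 d_sc Qx Qy).
by rewrite divr_ge0 // sqr_ge0.
Qed.

Lemma bregman_argmin_le x u :
  argmin Q d x -> Q u -> bregman d nabla_d x u <= d u - d x.
Proof.
move=> [Qx xmin] Qu.
have xmin0 : argmin Q (fun v => (0 : @dual_space R E) v + d v) x.
  by split=> // v Qv; rewrite !lfunE /= !add0r; exact: xmin.
have := argmin_first_order Q_convex d_C1 xmin0 Qu.
by rewrite add0r /bregman => ?; rewrite gerBl.
Qed.

(** Optimality of [y] and the three-point identity V(x,u) - V(y,u) - V(x,y) = (nabla_d y - nabla_d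
    x)(u - y) bound [h * p (y - u)]. The remaining [h * p (x - y)] is absorbed by V(x,y) >= |y -
    x|^2 / 2. *)
Lemma mirr_step (h : R) p x y u : 0 <= h -> Q x -> Q u ->
  mirr Q d nabla_d x (h *: p) y ->
  h * p (x - u) <=
    (h * dnorm p) ^+ 2 / 2 + bregman d nabla_d x u - bregman d nabla_d y u.
Proof.
move=> h0 Qx Qu [Qy ymin].
have ymin' : argmin Q (fun v => (h *: p - nabla_d x) v + d v) y.
  split=> // w Qw; have := ymin w Qw.
  by rewrite /bregman !sub_dualE !dualB; lra.
have := argmin_first_order Q_convex d_C1 ymin' Qu.
have := bregman_ge Q_convex d_C1 d_sc Qx Qy.
have := ler_wpM2l h0 (dual_le_dnorm p (x - y)).
rewrite add_dualE sub_dualE scale_dualE distrC mulrA /bregman !dualB.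
(* [s r <= s^2 / 2 + r^2 / 2] with [s = h * dnorm p] and [r = |y - x|] *)
have := sqr_ge0 (h * dnorm p - `|y - x|); rewrite sqrrB.
by lra.
Qed.

End MirrorDescent.

Theorem theorem4p1 (R : realType) (E : normedVectType R)
    (Q : set E) (d : E -> R) (nabla_d : E -> @dual_space R E)
    (U : set E) (f : E -> R) (nabla_f : E -> @dual_space R E)
    (g : E -> R) (nabla_g : E -> @dual_space R E) (Mg : R)
    (xs : E) (Theta0 eps : R) (N : nat) (x : nat -> E)
    (Q_closed : closed Q)
    (Q_convex : convex_set Q)
    (d_ge0 : forall y, Q y -> 0 <= d y)
    (d_C1 : C1_on Q d nabla_d)
    (d_sc : strongly_convex1_on Q nabla_d)
    (U_open : open U)
    (QU : Q `<=` U)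
    (f_lip : locally_lipschitz_on U f)
    (f_qc : quasi_convex_on Q f)
    (nabla_fP : forall y, Q y -> clarke_subdifferential f y (nabla_f y))
    (g_convex : convex_function Q g)
    (g_lip : forall y z, Q y -> Q z -> `|g y - g z| <= Mg * `|y - z|)
    (nabla_gP : forall y, Q y -> subdifferential_on Q g y (nabla_g y))
    (nabla_g_le : forall y, Q y -> dnorm (nabla_g y) <= Mg)
    (xsP : argmin (Q `&` [set y | g y <= 0]) f xs)
    (Theta0_gt0 : 0 < Theta0)
    (d_xs : d xs <= Theta0 ^+ 2)
    (eps_gt0 : 0 < eps)
    (NE : N%:Z = Num.ceil (2 * Theta0 ^+ 2 / eps ^+ 2))
    (run : amd_run Q d nabla_d g nabla_f nabla_g eps N x)
    (grad_neq0 : forall k, (k < N)%N ->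
       step_grad g nabla_f nabla_g eps (x k) <> 0) :
  let I : {set 'I_N} := [set k : 'I_N | productive g nabla_g eps (x k)]%SET in
  [/\ I <> finset.set0,
      (\big[mine/+oo]_(k in I) (vf nabla_f (x k) xs)%:E <= eps%:E)%E
    & (\big[maxe/-oo]_(k in I) (g (x k))%:E <= (eps * Mg)%:E)%E].
Proof.
move=> I.
have [[Qxs /= gxs] _] := xsP.
have [x0min steps] := run.
have Qx k : (k <= N)%N -> Q (x k).
  by case: k => [_|k kN]; [exact: x0min.1|exact: (steps k kN).1].
pose V k := bregman d nabla_d (x k) xs.
pose p k := step_grad g nabla_f nabla_g eps (x k).
have dp_gt0 k : (k < N)%N -> 0 < dnorm (p k) by move=> /grad_neq0 /dnorm_gt0.
have N_ge : Theta0 ^+ 2 <= N%:R * (eps ^+ 2 / 2).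
  have := ceil_ge (2 * Theta0 ^+ 2 / eps ^+ 2).
  rewrite -NE -pmulrn ler_pdivrMr ?exprn_gt0 // => NT.
  by rewrite mulrA ler_pdivlMr // mulrC.
have N_gt0 : (0 < N)%N.
  rewrite lt0n; apply/eqP => N0; move: N_ge.
  by rewrite N0 mul0r leNgt exprn_gt0.
have V_step k : (k < N)%N ->
    eps ^+ 2 < eps / dnorm (p k) * p k (x k - xs) ->
    V k.+1 + eps ^+ 2 / 2 < V k.
  move=> kN; have h0 : 0 <= eps / dnorm (p k).
    by rewrite divr_ge0 // ltW // dp_gt0.
  have := mirr_step Q_convex d_C1 d_sc h0 (Qx _ (ltnW kN)) Qxs (steps k kN).
  by rewrite divfK ?gt_eqF ?dp_gt0 // -/(V _) -/(V _); lra.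
(* One such index settles both [I <> finset.set0] and the bound on the minimum. *)
have [k0 k0I k0f] : exists2 k : 'I_N, k \in I & vf nabla_f (x k) xs <= eps.
  apply: contrapT => no_k.
  have V_decr k : (k < N)%N -> V k.+1 + eps ^+ 2 / 2 < V k.
    move=> kN; apply: V_step => //; have dp := dp_gt0 _ kN.
    rewrite mulrAC ltr_pdivlMr // expr2 -mulrA ltr_pM2l //.
    move: dp (grad_neq0 k kN); rewrite /p /step_grad.
    case: ifPn => [prod dp p0|nprod dp _].
      rewrite ltNge; apply/negP => fle; apply: no_k.
      exists (Ordinal kN); first by rewrite inE.
      (* The zero branch of [vf] is excluded by [grad_neq0]. *)
      rewrite /vf /=; case: eqP => // _; rewrite scale_dualE mulrC.
      by rewrite ler_pdivrMr.
    (* The subgradient inequality at [xs] gives [p k (x k - xs) >= g (x k) - g xs >= g (x k)], which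
       exceeds [eps * dnorm (p k)]. *)
    have := nabla_gP _ (Qx _ (ltnW kN)) xs Qxs; rewrite -(opprB (x k)).
    move: nprod; rewrite /productive -ltNge -scaleN1r dualZ.
    by move: gxs; lra.
  (* Not strict, so as to hold at [k = 0]; the strict inequality comes from the last step, [N.-1],
     which exists since [N > 0]. *)
  have V_sum k : (k <= N)%N -> V k + k%:R * (eps ^+ 2 / 2) <= V 0%N.
    elim: k => [_|k IH kN]; first by rewrite mul0r addr0.
    have := IH (ltnW kN); have := V_decr k kN.
    by rewrite -(natr1 k) mulrDl mul1r; lra.
  have V0 : V 0%N <= Theta0 ^+ 2.
    have := bregman_argmin_le Q_convex d_C1 x0min Qxs.
    by have := d_ge0 _ (Qx 0%N isT); rewrite -/(V 0%N); move: d_xs; lra.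
  have NM : N.-1.+1 = N := prednK N_gt0.
  have NR : N%:R = N.-1%:R + 1 :> R by rewrite natr1 NM.
  have VN : 0 <= V N := bregman_ge0 Q_convex d_C1 d_sc (Qx _ (leqnn _)) Qxs.
  have := V_decr N.-1; rewrite NM leqnn => /(_ isT).
  have := V_sum N.-1 (leq_pred N).
  by move: N_ge; rewrite NR mulrDl mul1r; lra.
split.
- by move=> I0; move: k0I; rewrite I0 finset.in_set0.
- by apply: (le_trans (bigmin_le_cond _ _ k0I)); rewrite lee_fin.
- apply: bigmax_le => [|k]; first exact: leNye.
  rewrite inE /productive lee_fin => /le_trans; apply.
  by rewrite ler_pM2l //; apply: nabla_g_le; exact: Qx (ltnW (ltn_ord k)).
Qed.
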